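(* Let $3<p<\infty$ and $\frac1p+\frac1q=1$. Let $\mathfrak J:l_p\to l_q$ be the mapping $\mathfrak J(x)=\left\{\frac{|t_n|^{p-1}\mathrm{sign}(t_n)}{1+|t_n|}\right\}_{n=1}^\infty$ for $x=(t_1,t_2,\dots)\in l_p$. Then $\mathfrak J$ is Mordukhovich differentiable in $l_p$ and, for $\bar x=\{\bar t_n\}_{n=1}^\infty\in l_p$, the Mordukhovich derivative $\widehat D^*\mathfrak J(\bar x):l_p\to l_q$ is equal to the Fréchet derivative $\nabla\mathfrak J(\bar x):l_p\to l_q$, with the representation $$\widehat D^*\mathfrak J(\bar x)=\nabla\mathfrak J(\bar x)=\begin{pmatrix}\frac{(p-1)|\bar t_1|^{p-2}+(p-2)|\bar t_1|^{p-1}}{(1+|\bar t_1|)^2}&0&\cdots\\0&\frac{(p-1)|\bar t_2|^{p-2}+(p-2)|\bar t_2|^{p-1}}{(1+|\bar t_2|)^2}&0\\\vdots&0&\ddots\end{pmatrix}.$$ More precisely, $\widehat D^*\mathfrak J(\bar x)=\nabla\mathfrak J(\bar x):l_p\to l_q$ is a pointwise multiplication operator in $l_p$ and, for any $v=\{t_n\}_{n=1}^\infty\in l_p$, $$\widehat D^*\mathfrak J(\bar x)(v)=\nabla\mathfrak J(\bar x)(v)=\left\{\frac{(p-1)|\bar t_n|^{p-2}+(p-2)|\bar t_n|^{p-1}}{(1+|\bar t_n|)^2}\,t_n\right\}_{n=1}^\infty\in l_q.$$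
   Context: $(l_p,\|\cdot\|_p)$ and $(l_q,\|\cdot\|_q)$ are the real sequence spaces, $l_p^*=l_q$, $l_q^*=l_p$, and $\langle\cdot,\cdot\rangle$ is the canonical real pairing $\sum_n a_nb_n$ of elements of $l_q$ and $l_p$. Infinite diagonal matrices act on sequences (viewed as row vectors) by entrywise multiplication by the diagonal entries. $\nabla\mathfrak J(\bar x)$ is the Fréchet derivative of $\mathfrak J$ at $\bar x$. The Mordukhovich derivative (Fréchet coderivative) of $\mathfrak J$ at $\bar x$ is the set-valued map $\widehat D^*\mathfrak J(\bar x)=\widehat D^*\mathfrak J(\bar x,\mathfrak J(\bar x)):l_p\rightrightarrows l_q$, $$\widehat D^*\mathfrak J(\bar x)(y)=\left\{z\in l_q:\limsup_{u\to\bar x,\,u\in l_p}\frac{\langle z,u-\bar x\rangle-\langle y,\mathfrak J(u)-\mathfrak J(\bar x)\rangle}{\|u-\bar x\|_p+\|\mathfrak J(u)-\mathfrak J(\bar x)\|_q}\le0\right\},\quad y\in l_p.$$ $\mathfrak J$ is Mordukhovich differentiable in $l_p$ if for every $\bar x\in l_p$ this set is a singleton for every $y\in l_p$; the singleton is then identified with its unique element. *)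

(* Defs.v *)
From HB Require Import structures.
From mathcomp Require Import finmap.
From mathcomp Require Import all_boot all_order all_algebra.
From mathcomp Require Import all_classical all_reals all_analysis.

Set Implicit Arguments.
Unset Strict Implicit.
Unset Printing Implicit Defensive.
Import Order.TTheory GRing.Theory Num.Theory.
Import numFieldNormedType.Exports.

Local Open Scope classical_set_scope.
Local Open Scope ring_scope.

(* The real sequence space l_p, 1 <= p < oo: sequences with finite L^p-norm
   for the counting measure on nat. *)
Definition lp (R : realType) (p : R) (p1 : (1 <= p%:E)%E) : Type :=
  LfunType (@counting nat R) p1.

Section lp_normed.
Context {R : realType} (p : R) (p1 : (1 <= p%:E)%E).

HB.instance Definition _ := GRing.Lmodule.copy (lp p1)
  (LfunType (@counting nat R) p1).

Definition lp_seq (x : lp p1) : nat -> R := (x : LfunType (@counting nat R) p1).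

Definition lp_norm (x : lp p1) : R :=
  fine ('N[@counting nat R]_p%:E[EFin \o lp_seq x]).

Lemma lp_ler_normD (x y : lp p1) : lp_norm (x + y) <= lp_norm x + lp_norm y.
Proof. exact: ler_LnormD. Qed.

Lemma lp_normrZ (l : R) (x : lp p1) : lp_norm (l *: x) = `|l| * lp_norm x.
Proof. by apply: EFin_inj; rewrite EFinM !finite_norm_fine LnormZ. Qed.

Lemma lp_normr0_eq0 (x : lp p1) : lp_norm x = 0 -> x = 0.
Proof.
move=> /fine_Lnormr_eq0 [A [mA A0 subA]].
suff Ae : A = set0.
  apply/LfuneqP => n; apply: contrapT => xn.
  by have : A n; [apply: subA => /=; tauto | rewrite Ae].
move: A0; rewrite /= /counting; case: asboolP => // finA.
move=> /eqP; rewrite eqe pnatr_eq0 cardfs_eq0 => /eqP A0.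
by rewrite -(fset_setK finA) A0 set_fset0.
Qed.

HB.instance Definition _ := Lmodule_isNormed.Build R (lp p1)
  lp_ler_normD lp_normrZ lp_normr0_eq0.

End lp_normed.

Coercion lp_seq : lp >-> Funclass.

Lemma lp_normE (R : realType) (p : R) (p1 : (1 <= p%:E)%E) (x : lp p1) :
  `|x| = fine ((\sum_(k <oo) (`|x k| `^ p)%:E) `^ p^-1)%E.
Proof.
rewrite /Num.norm /= /lp_norm Lnorm_counting//.
by rewrite (lt_le_trans ltr01)// -lee_fin.
Qed.

Lemma mem_lp (R : realType) (p : R) (x : nat -> R) : (1 <= p%:E)%E ->
  (\sum_(k <oo) (`|x k| `^ p)%:E < +oo)%E <-> x \in Lfun (@counting nat R) p%:E.
Proof.
rewrite lee_fin => p1; have p0 : 0 < p := lt_le_trans ltr01 p1.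
have -> : (x \in Lfun (@counting nat R) p%:E) =
    ('N[@counting nat R]_p%:E[EFin \o x] < +oo)%E.
  rewrite inE /=; apply/andP/idP => [[_ /[!inE]]//|xp].
  by split; rewrite inE//; exact: measurable_funS (discrete_measurable_fun _).
rewrite Lnorm_counting//; split=> [|/lty_poweRy]; first exact: poweR_lty.
by apply; rewrite gt_eqF// invr_gt0.
Qed.

(* For a in l_q and b in l_p (or conversely) the series converges, by Hoelder. *)
Definition pairing (R : realType) (a b : nat -> R) : R :=
  limn (series (fun n => a n * b n)).

Section coderivative.
Context {R : realType} (p q : R) (p1 : (1 <= p%:E)%E) (q1 : (1 <= q%:E)%E).
Implicit Types (f : lp p1 -> lp q1) (x y : lp p1).

(* Elements of the duals of l_p and l_q are represented by elements of l_q and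
   l_p through [pairing]. The upper limit is over punctured neighbourhoods. *)
Definition coderivative f x y : set (lp q1) :=
  [set z | (limf_esup (fun u : lp p1 =>
     ((pairing z (u - x) - pairing y (f u - f x)) /
      (`|u - x| + `|f u - f x|))%:E) x^' <= 0)%E].

Definition mordukhovich_differentiable f :=
  forall x y, exists z, coderivative f x y = [set z].

End coderivative.

(* Action on v of the infinite diagonal matrix with diagonal d. *)
Definition diag_mul (R : realType) (d v : nat -> R) : nat -> R :=
  fun n => d n * v n.

Section J_map.
Context {R : realType} (p q : R).

Lemma exponent_ge1 : 3 < p -> (1 <= p%:E)%E.
Proof. by rewrite lee_fin => p3; apply/ltW/(lt_trans _ p3); rewrite ltr1n. Qed.

Lemma conjugate_ge1 : 3 < p -> p^-1 + q^-1 = 1 -> (1 <= q%:E)%E.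
Proof.
move=> p3 pq; have p0 : 0 < p by rewrite (lt_trans _ p3).
have qE : q^-1 = 1 - p^-1 by rewrite -pq addrC addKr.
have q0 : 0 < q^-1.
  by rewrite qE subr_gt0 invf_lt1// (lt_trans _ p3)// ltr1n.
rewrite lee_fin -[q]invrK invf_ge1// qE gerBl invr_ge0 ltW//.
Qed.

Definition J_seq (x : nat -> R) : nat -> R :=
  fun n => `|x n| `^ (p - 1) * Num.sg (x n) / (1 + `|x n|).

Hypotheses (p3 : 3 < p) (pq : p^-1 + q^-1 = 1).

Lemma J_seq_lp (x : lp (exponent_ge1 p3)) :
  J_seq x \in Lfun (@counting nat R) q%:E.
Proof.
have p0 : 0 < p by rewrite (lt_trans _ p3).
have q1 : 1 <= q by rewrite -lee_fin (conjugate_ge1 p3).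
have q0 : 0 < q := lt_le_trans ltr01 q1.
have pqE : (p - 1) * q = p.
  have : (p^-1 + q^-1) * (p * q) = q + p.
    by rewrite mulrDl mulKf ?gt_eqF// mulrCA mulVf ?gt_eqF// mulr1.
  by rewrite pq mul1r mulrBl mul1r => ->; rewrite addrAC subrr add0r.
apply/mem_lp; first exact: conjugate_ge1 p3 pq.
apply: (@le_lt_trans _ _ (\sum_(k <oo) (`|x k| `^ p)%:E)%E); last first.
  by apply/(mem_lp _ (exponent_ge1 p3)); exact: LfunP.
apply: lee_nneseries => [k _|k _]; first by rewrite lee_fin powR_ge0.
rewrite lee_fin.
have -> : `|x k| `^ p = (`|x k| `^ (p - 1)) `^ q by rewrite -powRrM pqE.
rewrite ge0_ler_powR ?nnegrE ?powR_ge0 ?(ltW q0)//.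
have d1 : 1 <= 1 + `|x k| by rewrite lerDl.
rewrite normrM normrV ?unitfE ?gt_eqF ?(lt_le_trans ltr01 d1)//.
rewrite (ger0_norm (le_trans ler01 d1)) ler_pdivrMr ?(lt_le_trans ltr01 d1)//.
rewrite normrM (ger0_norm (powR_ge0 _ _)) ler_wpM2l ?powR_ge0//.
by rewrite (le_trans _ d1)// normr_sg lern1 leq_b1.
Qed.

Definition J (x : lp (exponent_ge1 p3)) : lp (conjugate_ge1 p3 pq) :=
  Lfun_Sub (conjugate_ge1 p3 pq) (J_seq_lp x).

Definition J_multiplier (x : nat -> R) : nat -> R := fun n =>
  ((p - 1) * `|x n| `^ (p - 2) + (p - 2) * `|x n| `^ (p - 1)) /
  (1 + `|x n|) ^+ 2.

End J_map.

Arguments J {R p q} p3 pq x.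

(* Main.v *)
Require Import Defs.
From HB Require Import structures.
From mathcomp Require Import all_boot all_order all_algebra.
From mathcomp Require Import all_classical all_reals all_analysis.
From mathcomp Require Import ring lra.

(** The map [J] acts entrywise through the scalar function
    [phi t = |t|^(p-1) sgn t / (1 + |t|)], whose second derivative is at most
    a multiple of [|t|^(p-3)].  Hence the entries of the Taylor remainder
    [J (x + h) - J x - m h], where [m = phi' x] entrywise, are bounded by
    [4 p^2 (|x n| + |h n|)^(p-3) (h n)^2] ([damped_power_taylor]).

    The passage from this entrywise bound to a norm bound rests on
    [q (p - 1) = p]: a sequence dominated by [c |w|^(p-1)] with [w] in l_p lies in
    l_q, with norm at most [c ||w||^(p-1)] ([lq_norm_dominated]).  To bring the
    remainder to this shape, write [h = ||h|| k] with [||k|| = 1].  For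
    [||h|| <= 1] the bound is at most [4 p^2 ||h||^2 (|x n| + |k n|)^(p-1)], so the
    remainder has norm at most [4 p^2 (||x|| + 1)^(p-1) ||h||^2]
    ([J_remainder]).  Thus [J] is Frechet differentiable and its derivative is
    multiplication by [m] ([J_differentiable]).

    The coderivative of any Frechet differentiable map [f] at [x] sends [y] to
    the functionals [z] with [<z, v> = <y, 'd f x v>] for all [v]
    ([coderivative_differentiable]).  Indeed the first order expansion of [f]
    turns the quotient of the definition into
    [(<z, v> - <y, 'd f x v>) / (||v|| + ||f (x + v) - f x||)] up to [o(1)], the
    denominator being comparable to [||v||]; so the upper limit is nonpositive
    exactly when the linear functional [<z, .> - <y, 'd f x .>] is nonpositive,
    that is, zero.  Multiplication by [m] is its own adjoint for the pairing
    ([pairing_multiplier_op]), and testing against the unit sequences shows that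
    the only such [z] is [m y]. *)

Set Implicit Arguments.
Unset Strict Implicit.
Unset Printing Implicit Defensive.
Import Order.TTheory GRing.Theory Num.Theory.
Import numFieldNormedType.Exports.

Local Open Scope classical_set_scope.
Local Open Scope ring_scope.

(** * The scalar function *)

Definition damped_power (R : realType) (p t : R) : R :=
  `|t| `^ (p - 1) * Num.sg t / (1 + `|t|).

Definition damped_power_deriv (R : realType) (p t : R) : R :=
  ((p - 1) * `|t| `^ (p - 2) + (p - 2) * `|t| `^ (p - 1)) / (1 + `|t|) ^+ 2.

Section scalar.
Context {R : realType}.
Implicit Types p s t h a b : R.

(** The end points come in either order because the increments of the argument
    have either sign. *)
Lemma MVT_positive (f df : R -> R) a b : 0 < a -> 0 < b ->
  (forall c : R, 0 < c -> is_derive c 1 f (df c)) ->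
  exists2 c, Num.min a b <= c <= Num.max a b & f b - f a = df c * (b - a).
Proof.
move=> + + fdf; wlog ab : a b / a <= b => [hwlog a0 b0|a0 _].
  have [ab|ba] := orP (le_total a b); first exact: hwlog.
  have [c cab E] := hwlog _ _ ba b0 a0; exists c; first by rewrite minC maxC.
  by rewrite -opprB E -mulrN opprB.
have fd (c : R) : a <= c -> is_derive c 1 f (df c).
  by move=> ac; apply: fdf; exact: lt_le_trans ac.
have [||c] := @MVT_segment R f df a b ab.
- by move=> c /[!in_itv]/= /andP[/ltW /fd].
- apply: derivable_within_continuous => c /[!in_itv]/= /andP[/fd fc _].
  exact: ex_derive.
- by rewrite in_itv/= => cab E; exists c; rewrite ?(min_idPl ab) ?(max_idPr ab).
Qed.

Lemma powR_sub_le s a b : 1 <= s -> 0 <= a <= b ->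
  b `^ s - a `^ s <= s * b `^ (s - 1) * (b - a).
Proof.
move=> s1 /andP[a0 ab]; have s0 : 0 < s by lra.
have b0 := le_trans a0 ab.
move: a0; rewrite le_eqVlt => /predU1P[a0|a0].
  rewrite -a0 powR0 ?gt_eqF// !subr0 -mulrA [_ * b]mulrC mulr_powRB1//.
  by rewrite ler_peMl ?powR_ge0.
have [c + ->] := @MVT_positive (@powR R ^~ s) (fun c => s * c `^ (s - 1)) a b
  a0 (lt_le_trans a0 ab) (fun c => @is_derive1_powR R s c).
rewrite (min_idPl ab) (max_idPr ab) => /andP[ac cb].
rewrite ler_wpM2r ?subr_ge0// ler_wpM2l ?(ltW s0)// ge0_ler_powR ?nnegrE//; lra.
Qed.

(** In this form the derivative is a power times a bounded factor whose own
    derivative is [O(1 / (1 + |t|))]; both the growth bound and the Lipschitz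
    bound below read off from it. *)
Lemma damped_power_derivE p t : 3 < p -> damped_power_deriv p t =
  `|t| `^ (p - 2) * ((p - 2) / (1 + `|t|) + (1 + `|t|)^-1 ^+ 2).
Proof.
move=> p3; rewrite /damped_power_deriv.
have -> : `|t| `^ (p - 1) = `|t| * `|t| `^ (p - 2).
  by rewrite -(_ : p - 1 - 1 = p - 2) ?mulr_powRB1//; lra.
by field; rewrite gt_eqF// ltr_pwDl.
Qed.

Lemma damped_power_deriv_ge0 p t : 3 < p -> 0 <= damped_power_deriv p t.
Proof.
by move=> p3; rewrite /damped_power_deriv divr_ge0 ?exprn_ge0 ?addr_ge0 ?mulr_ge0
  ?powR_ge0//; lra.
Qed.

Lemma damped_power_deriv_le p t : 3 < p ->
  damped_power_deriv p t <= (p - 1) * `|t| `^ (p - 2).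
Proof.
move=> p3; rewrite damped_power_derivE// [leRHS]mulrC ler_wpM2l ?powR_ge0//.
have -> : p - 1 = (p - 2) * 1 + 1 ^+ 2 by ring.
have i0 : 0 <= (1 + `|t|)^-1 by rewrite invr_ge0 addr_ge0.
have i1 : (1 + `|t|)^-1 <= 1 by rewrite invf_le1 ?ltr_pwDl// lerDl.
by rewrite lerD ?lerXn2r ?nnegrE// ler_wpM2l//; lra.
Qed.

Lemma damped_power_le p t : `|damped_power p t| <= `|t| `^ (p - 1).
Proof.
rewrite /damped_power !normrM (ger0_norm (powR_ge0 _ _)) normrV ?unitfE; last first.
  by rewrite gt_eqF// ltr_pwDl.
rewrite -mulrA ler_piMr ?powR_ge0// mulr_ile1 ?invr_ge0//.
  by rewrite normr_sg lern1 leq_b1.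
by rewrite ger0_norm ?addr_ge0// invf_le1 ?ltr_pwDl// lerDl.
Qed.

Lemma damped_powerN p t : damped_power p (- t) = - damped_power p t.
Proof. by rewrite /damped_power normrN sgrN mulrN mulNr. Qed.

Lemma damped_power_derivN p t : damped_power_deriv p (- t) = damped_power_deriv p t.
Proof. by rewrite /damped_power_deriv normrN. Qed.

Lemma is_derive_damped_power p t : 3 < p -> 0 < t ->
  is_derive t 1 (damped_power p) (damped_power_deriv p t).
Proof.
move=> p3 t0.
have t1 : 1 + t != 0 by rewrite gt_eqF// addr_gt0.
apply: (@near_eq_is_derive _ _ _ (fun u => u `^ (p - 1) * (1 + u)^-1)).
  near=> u; have u0 : 0 < u by near: u; exact: lt_nbhsr.
  by rewrite /damped_power gtr0_norm// gtr0_sg// mulr1.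
have d1 := is_derive1_powR (p - 1) t0.
have d2 : is_derive t 1 (fun u : R => 1 + u) 1.
  by apply: is_derive_eq; rewrite add0r mulr1.
have d3 := is_deriveV t1 d2.
apply: (is_derive_eq (is_deriveM d1 d3)).
rewrite /damped_power_deriv gtr0_norm// /GRing.scale/=.
have -> : p - 1 - 1 = p - 2 by ring.
have -> : t `^ (p - 1) = t * t `^ (p - 2).
  by rewrite -(_ : p - 1 - 1 = p - 2) ?mulr_powRB1 ?ltW//; lra.
by field.
Unshelve. all: by end_near. Qed.

(** Write the derivative as [t^(p-2) g t].  The increment of the power costs
    [(p-2) b^(p-3) (b-a)] and [g] is at most [p-1]; the increment of [g] is at
    most [p (b-a) / (1+b)], and [b^(p-2) / (1+b) <= b^(p-3)].  The total constant
    [(p-2)(p-1) + p] is below [p^2]. *)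
Lemma damped_power_deriv_lipschitz p a b : 3 < p -> 0 <= a <= b ->
  `|damped_power_deriv p b - damped_power_deriv p a| <= p ^+ 2 * b `^ (p - 3) * (b - a).
Proof.
move=> p3 /andP[a0 ab]; have b0 := le_trans a0 ab.
rewrite !damped_power_derivE// (ger0_norm a0) (ger0_norm b0).
pose g t := (p - 2) / (1 + t) + (1 + t)^-1 ^+ 2.
rewrite -/(g a) -/(g b).
have -> : b `^ (p - 2) * g b - a `^ (p - 2) * g a =
  (b `^ (p - 2) - a `^ (p - 2)) * g a + b `^ (p - 2) * (g b - g a) by ring.
have ia0 : 0 <= (1 + a)^-1 by rewrite invr_ge0 addr_ge0.
have ia1 : (1 + a)^-1 <= 1 by rewrite invf_le1 ?ltr_pwDl// lerDl.
have ib0 : 0 <= (1 + b)^-1 by rewrite invr_ge0 addr_ge0.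
have ib1 : (1 + b)^-1 <= 1 by rewrite invf_le1 ?ltr_pwDl// lerDl.
have ga0 : 0 <= g a by rewrite addr_ge0 ?exprn_ge0// mulr_ge0//; lra.
have gap : g a <= p - 1.
  have -> : p - 1 = (p - 2) * 1 + 1 ^+ 2 by ring.
  by rewrite lerD ?lerXn2r ?nnegrE// ler_wpM2l//; lra.
have pow0 : 0 <= b `^ (p - 3) by rewrite powR_ge0.
have pw : b `^ (p - 2) = b * b `^ (p - 3).
  by rewrite -(_ : p - 2 - 1 = p - 3) ?mulr_powRB1//; lra.
have pm : a `^ (p - 2) <= b `^ (p - 2) by rewrite ge0_ler_powR ?nnegrE//; lra.
have p21 : 1 <= p - 2 by lra.
have ps := powR_sub_le p21 (introT andP (conj a0 ab)).
rewrite (_ : p - 2 - 1 = p - 3) in ps; last by ring.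
have gB : g b - g a = - ((b - a) * (1 + b)^-1 * (1 + a)^-1 *
    ((p - 2) + (1 + a)^-1 + (1 + b)^-1)).
  by rewrite /g; field; rewrite !gt_eqF// ltr_pwDl.
have h1 : (b `^ (p - 2) - a `^ (p - 2)) * g a <=
    (p - 2) * b `^ (p - 3) * (b - a) * (p - 1).
  by apply: ler_pM => //; rewrite subr_ge0.
have bb : 0 <= b * (1 + b)^-1 <= 1.
  by rewrite mulr_ge0//= ler_pdivrMr ?ltr_pwDl// mul1r lerDr.
have h2 : `|b `^ (p - 2) * (g b - g a)| <= b `^ (p - 3) * (b - a) * p.
  rewrite gB pw.
  have -> : b * b `^ (p - 3) * - ((b - a) / (1 + b) / (1 + a) *
      (p - 2 + (1 + a)^-1 + (1 + b)^-1)) = - (b `^ (p - 3) * (b - a) *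
      ((b / (1 + b)) * (1 + a)^-1 * (p - 2 + (1 + a)^-1 + (1 + b)^-1))) by ring.
  have ba0 : 0 <= b - a by rewrite subr_ge0.
  move: (b * (1 + b)^-1) (1 + a)^-1 (1 + b)^-1 bb ia0 ia1 ib0 ib1.
  move=> c ia ib /andP[c0 c1] ia0' ia1' ib0' ib1'.
  have s0 : 0 <= p - 2 + ia + ib by lra.
  have sp : p - 2 + ia + ib <= p by lra.
  rewrite normrN normrM ger0_norm ?mulr_ge0// ler_wpM2l ?mulr_ge0//.
  by rewrite ger0_norm ?mulr_ge0// -[leRHS]mul1r ler_pM ?mulr_ge0// mulr_ile1.
apply: (le_trans (ler_normD _ _)).
rewrite ger0_norm; last by rewrite mulr_ge0// subr_ge0.
apply: (le_trans (lerD h1 h2)).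
have -> : (p - 2) * b `^ (p - 3) * (b - a) * (p - 1) + b `^ (p - 3) * (b - a) * p
  = ((p - 2) * (p - 1) + p) * b `^ (p - 3) * (b - a) by ring.
rewrite ler_wpM2r ?subr_ge0// ler_wpM2r//; nra.
Qed.

(** When [|h|] is at least [|t|], each of the three terms is already of the order
    of [(|t| + |h|)^(p-1)], and [|t| + |h| <= 2 |h|].  Otherwise [t] and [t + h]
    have the same sign, positive after using the oddness of the function, and the
    mean value theorem combines with the Lipschitz bound on the derivative. *)
Lemma damped_power_taylor p t h : 3 < p ->
  `|damped_power p (t + h) - damped_power p t - damped_power_deriv p t * h| <=
  4 * p ^+ 2 * ((`|t| + `|h|) `^ (p - 3) * h ^+ 2).
Proof.
move=> p3; set S := `|t| + `|h|.
have S0 : 0 <= S by rewrite addr_ge0.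
have pow0 : 0 <= S `^ (p - 3) by rewrite powR_ge0.
have hh : h ^+ 2 = `|h| ^+ 2 by rewrite real_normK ?num_real.
have pw2 : S `^ (p - 2) = S * S `^ (p - 3).
  by rewrite -(_ : p - 2 - 1 = p - 3) ?mulr_powRB1//; lra.
have pw1 : S `^ (p - 1) = S ^+ 2 * S `^ (p - 3).
  rewrite expr2 -mulrA -pw2.
  by rewrite -(_ : p - 1 - 1 = p - 2) ?mulr_powRB1//; lra.
have mono u r : 0 <= r -> `|u| <= S -> `|u| `^ r <= S `^ r.
  by move=> r0 uS; rewrite ge0_ler_powR ?nnegrE.
have tS : `|t| <= S by rewrite lerDl.
have [th|ht] := leP `|t| `|h|.
  have h1 : `|damped_power p (t + h)| <= S `^ (p - 1).
    by rewrite (le_trans (damped_power_le _ _))// mono ?ler_normD//; lra.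
  have h2 : `|damped_power p t| <= S `^ (p - 1).
    by rewrite (le_trans (damped_power_le _ _))// mono//; lra.
  have h3 : `|damped_power_deriv p t * h| <= (p - 1) * S `^ (p - 1).
    rewrite normrM ger0_norm ?damped_power_deriv_ge0//.
    have -> : (p - 1) * S `^ (p - 1) = ((p - 1) * S `^ (p - 2)) * S.
      by rewrite pw1 pw2; ring.
    apply: ler_pM; rewrite ?damped_power_deriv_ge0 ?lerDr//.
    apply: (le_trans (damped_power_deriv_le _ p3)).
    by rewrite ler_wpM2l ?mono//; lra.
  apply: (le_trans (ler_normB _ _)); apply: (le_trans (lerD (ler_normB _ _) h3)).
  apply: (le_trans (lerD (lerD h1 h2) (lexx _))).
  rewrite pw1 hh.
  have SS : S ^+ 2 <= 4 * `|h| ^+ 2.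
    have -> : 4 * `|h| ^+ 2 = (2 * `|h|) ^+ 2 by ring.
    rewrite lerXn2r ?nnegrE ?mulr_ge0// /S; lra.
  have -> : S ^+ 2 * S `^ (p - 3) + S ^+ 2 * S `^ (p - 3) +
     (p - 1) * (S ^+ 2 * S `^ (p - 3)) = (p + 1) * (S `^ (p - 3) * S ^+ 2) by ring.
  have -> : 4 * p ^+ 2 * (S `^ (p - 3) * `|h| ^+ 2) =
    p ^+ 2 * (S `^ (p - 3) * (4 * `|h| ^+ 2)) by ring.
  apply: ler_pM; rewrite ?mulr_ge0 ?exprn_ge0 ?ler_wpM2l//; nra.
have t0 : 0 < `|t| by exact: le_lt_trans ht.
have pos k : `|k| = `|h| ->
    `|damped_power p (`|t| + k) - damped_power p `|t| -
      damped_power_deriv p `|t| * k| <= p ^+ 2 * (S `^ (p - 3) * h ^+ 2).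
  move=> kh; have := ht; rewrite -kh ltr_norml => /andP[tk _].
  have tk0 : 0 < `|t| + k by lra.
  have tkS : `|t| + k <= S by rewrite lerD2l -kh ler_norm.
  have [c cI ->] := MVT_positive t0 tk0 (fun c => @is_derive_damped_power p c p3).
  rewrite (_ : `|t| + k - `|t| = k); last by ring.
  rewrite -mulrBl normrM hh -{}kh [`|k| ^+ 2]expr2 !mulrA ler_wpM2r//.
  have {cI} [c0 cS ck] : [/\ 0 <= c, c <= S & `|c - `|t| | <= `|k|].
    move: cI; rewrite ge_min le_max.
    case: (leP 0 k) => k0; [rewrite (ger0_norm k0)|rewrite (ltr0_norm k0)];
      rewrite ler_distl => /andP[/orP[] ? /orP[] ?]; split; try apply/andP; try split; lra.
  have dom a b : 0 <= a <= b -> b <= S -> b - a <= `|k| ->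
      `|damped_power_deriv p b - damped_power_deriv p a| <=
      p ^+ 2 * S `^ (p - 3) * `|k|.
    move=> /[dup] /andP[a0 ab] aab bS bk.
    apply: (le_trans (damped_power_deriv_lipschitz p3 aab)).
    have b0 := le_trans a0 ab.
    apply: ler_pM => //; rewrite ?subr_ge0//.
      by rewrite mulr_ge0 ?powR_ge0// sqr_ge0.
    by rewrite ler_wpM2l ?sqr_ge0// ge0_ler_powR ?nnegrE//; lra.
  move: ck; rewrite ler_norml => /andP[ck1 ck2].
  have [tc|/ltW ct] := leP `|t| c.
    by apply: dom => //; apply/andP; split.
  by rewrite distrC; apply: dom => //; [apply/andP; split|lra].
have le4 : p ^+ 2 * (S `^ (p - 3) * h ^+ 2) <= 4 * p ^+ 2 * (S `^ (p - 3) * h ^+ 2).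
  by rewrite -[_ * p ^+ 2 * _]mulrA ler_peMl ?ler1n// mulr_ge0 ?sqr_ge0// mulr_ge0 ?sqr_ge0.
apply: le_trans le4.
have [tge0|tlt0] := leP 0 t; first by have := pos h erefl; rewrite (ger0_norm tge0).
have := pos (- h) (normrN _); rewrite (ltr0_norm tlt0) -opprD !damped_powerN.
by rewrite damped_power_derivN mulrN -!opprD normrN.
Qed.

End scalar.

(** * Domination in sequence spaces *)

Section sequence_spaces.
Context {R : realType}.
Implicit Types p q r c : R.

Lemma lp_ext p (p1 : (1 <= p%:E)%E) (x y : lp p1) : x =1 y -> x = y.
Proof. by move=> xy; apply/LfuneqP. Qed.

Lemma lp_exponent_gt0 p : (1 <= p%:E)%E -> 0 < p.
Proof. by rewrite lee_fin; exact: lt_le_trans. Qed.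

(** This form of the norm is an equation between finite quantities, free of the
    root and of [fine]. *)
Lemma lp_sum_powE p (p1 : (1 <= p%:E)%E) (x : lp p1) :
  (\sum_(k <oo) (`|x k| `^ p)%:E = (`|x| `^ p)%:E)%E.
Proof.
have p0 := lp_exponent_gt0 p1.
have := (mem_lp x p1).2 (LfunP _); rewrite lp_normE.
have : (0 <= \sum_(k <oo) (`|x k| `^ p)%:E)%E.
  by apply: nneseries_ge0 => k _ _; rewrite lee_fin powR_ge0.
case: (\sum_(_ <oo) _)%E => //= s; rewrite lee_fin => s0 _.
by rewrite -powRrM mulVf ?gt_eqF// powRr1.
Qed.

Lemma sum_pow_dominated p q r c (p1 : (1 <= p%:E)%E) (x : lp p1) (z : nat -> R) :
  0 < q -> r * q = p -> 0 <= c -> (forall n, `|z n| <= c * `|x n| `^ r) ->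
  (\sum_(k <oo) (`|z k| `^ q)%:E <= ((c * `|x| `^ r) `^ q)%:E)%E.
Proof.
move=> q0 rqp c0 zx.
rewrite powRM ?powR_ge0// -powRrM rqp EFinM -lp_sum_powE -nneseriesZl; last first.
  by move=> k _; rewrite lee_fin powR_ge0.
apply: lee_nneseries => [k _|k _]; first by rewrite lee_fin powR_ge0.
have -> : `|x k| `^ p = (`|x k| `^ r) `^ q by rewrite -powRrM rqp.
rewrite -EFinM lee_fin -powRM ?powR_ge0//.
by rewrite ge0_ler_powR ?nnegrE ?(ltW q0) ?mulr_ge0 ?powR_ge0.
Qed.

Lemma mem_lq_dominated p q r c (p1 : (1 <= p%:E)%E) (x : lp p1) (z : nat -> R) :
  (1 <= q%:E)%E -> r * q = p -> 0 <= c -> (forall n, `|z n| <= c * `|x n| `^ r) ->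
  z \in Lfun (@counting nat R) q%:E.
Proof.
move=> q1 rqp c0 zx; apply/mem_lp => //.
by rewrite (le_lt_trans (sum_pow_dominated _ rqp c0 zx)) ?ltry ?lp_exponent_gt0.
Qed.

(** For [r = p / q] the map [t |-> |t|^r] sends l_p into l_q, homogeneously of
    degree [r].  A product of powers of total degree [r] falls under this bound
    once its factors are majorized by a single sequence. *)
Lemma lq_norm_dominated p q r c (p1 : (1 <= p%:E)%E) (q1 : (1 <= q%:E)%E)
    (x : lp p1) (z : lp q1) :
  r * q = p -> 0 <= c -> (forall n, `|z n| <= c * `|x n| `^ r) ->
  `|z| <= c * `|x| `^ r.
Proof.
move=> rqp c0 zx; have q0 := lp_exponent_gt0 q1.
have := sum_pow_dominated q0 rqp c0 zx; rewrite lp_sum_powE lee_fin.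
apply: contraTT; rewrite -!ltNge => h.
by rewrite gt0_ltr_powR ?nnegrE ?mulr_ge0 ?powR_ge0.
Qed.

(** A single majorant of two sequences, to which domination can be applied. *)
Lemma lp_sum_of_norms p (p1 : (1 <= p%:E)%E) (x y : lp p1) :
  exists2 w : lp p1, (forall n, w n = `|x n| + `|y n|) & `|w| <= `|x| + `|y|.
Proof.
have abs_le (u : lp p1) n : `| `|u n| | <= 1 * `|u n| `^ 1.
  by rewrite normr_id powRr1// mul1r.
have lp_abs (u : lp p1) : exists2 v : lp p1, (forall n, v n = `|u n|) & `|v| <= `|u|.
  have mem := mem_lq_dominated p1 (mul1r p) ler01 (abs_le u).
  exists (Lfun_Sub p1 mem) => //.
  rewrite -[leRHS]powRr1// -[leRHS]mul1r.
  by apply: (lq_norm_dominated (mul1r p) ler01) => n; exact: abs_le.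
have [x' x'E x'x] := lp_abs x; have [y' y'E y'y] := lp_abs y.
exists (x' + y'); first by move=> n; rewrite -x'E -y'E.
by rewrite (le_trans (ler_normD _ _))// lerD.
Qed.

End sequence_spaces.

(** * The pairing of l_p and l_q *)

Section duality.
Context {R : realType} (p q : R) (p1 : (1 <= p%:E)%E) (q1 : (1 <= q%:E)%E).
Hypothesis pq : p^-1 + q^-1 = 1.

Let hoelder_series (a : lp p1) (b : lp q1) :
  (\sum_(k <oo) `|a k * b k|%:E <= (`|a| * `|b|)%:E)%E.
Proof.
have mf (f : nat -> R) : measurable_fun setT f by [].
have := hoelder (@counting nat R) (mf a) (mf b) (lp_exponent_gt0 p1)
  (lp_exponent_gt0 q1) pq.
rewrite EFinM !finite_norm_fine; apply: le_trans.
rewrite Lnorm_counting// invr1 poweRe1; last first.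
  by apply: nneseries_ge0 => k _ _; exact: poweR_ge0.
apply: lee_nneseries => [k _|k _]; first by rewrite lee_fin.
by rewrite poweRe1.
Qed.

Let partial_sum_le (a : lp p1) (b : lp q1) n :
  [normed series (fun n => a n * b n)] n <= `|a| * `|b|.
Proof.
rewrite -lee_fin; apply: le_trans (hoelder_series a b).
rewrite /series/= -sumEFin big_mkord -(big_mkord xpredT (fun k => `|a k * b k|%:E)).
exact: nneseries_lim_ge.
Qed.

Let normed_cvg_pairing (a : lp p1) (b : lp q1) :
  cvgn [normed series (fun n => a n * b n)].
Proof.
apply: nondecreasing_is_cvgn.
  by apply: nondecreasing_series => n _ _; exact: normr_ge0.
by exists (`|a| * `|b|) => _ [n _ <-]; exact: partial_sum_le.
Qed.

Lemma cvg_pairing (a : lp p1) (b : lp q1) : cvgn (series (fun n => a n * b n)).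
Proof. by apply: normed_cvg; exact: normed_cvg_pairing. Qed.

Lemma pairing_le (a : lp p1) (b : lp q1) : `|pairing a b| <= `|a| * `|b|.
Proof.
apply: le_trans; first by apply: lim_series_norm; exact: normed_cvg_pairing.
apply: limr_le; first exact: normed_cvg_pairing.
by apply: nearW => n; exact: partial_sum_le.
Qed.

Lemma pairing_linear (a : lp p1) (b b' : lp q1) c :
  pairing a (c *: b + b') = c * pairing a b + pairing a b'.
Proof.
rewrite /pairing -[c * _]lim_seriesZ; last exact: cvg_pairing.
rewrite -lim_seriesD; [|apply: is_cvg_seriesZ|]; try exact: cvg_pairing.
congr (limn (series _)); apply/funext => n.
by rewrite -[LHS]/(a n * (c * b n + b' n)) mulrDr mulrCA.
Qed.

Lemma pairing0 (a : lp p1) : pairing a (0 : lp q1) = 0.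
Proof. by have := pairing_linear a 0 0 1; rewrite scaler0 addr0 mul1r; lra. Qed.

Lemma pairingZ (a : lp p1) (b : lp q1) c : pairing a (c *: b) = c * pairing a b.
Proof. by rewrite -[c *: b]addr0 pairing_linear pairing0 addr0. Qed.

Lemma pairingN (a : lp p1) (b : lp q1) : pairing a (- b) = - pairing a b.
Proof. by rewrite -scaleN1r pairingZ mulN1r. Qed.

Lemma pairingB (a : lp p1) (b b' : lp q1) :
  pairing a (b - b') = pairing a b - pairing a b'.
Proof. by rewrite addrC -scaleN1r pairing_linear mulN1r addrC. Qed.

End duality.

(** * Coderivatives of differentiable maps *)

(** This removes the extended reals from the definition of the coderivative. *)
Lemma limf_esup_le0P (R : realType) (T : topologicalType) (F : set_system T)
    {FF : Filter F} (f : T -> R) :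
  (limf_esup (fun u => (f u)%:E) F <= 0)%E <->
  forall e, 0 < e -> \forall u \near F, f u <= e.
Proof.
rewrite limf_esupE; split=> [f0 e e0|fe].
  have : (ereal_inf [set ereal_sup [set (f u)%:E | u in V] | V in F] < e%:E)%E.
    by rewrite (le_lt_trans f0)// lte_fin.
  move=> /ereal_inf_lt[_ [V FV <-] /ltW Ve]; apply: filterS FV => u Vu.
  by rewrite -lee_fin (le_trans _ Ve)//; apply: ereal_sup_ubound; exists u.
apply/lee_addgt0Pr => e e0; rewrite add0e.
apply: (@le_trans _ _ (ereal_sup [set (f u)%:E | u in [set u | f u <= e]])).
  by apply: ereal_inf_lbound; exists [set u | f u <= e] => //; exact: fe.
by apply: ge_ereal_sup => _ [u /= fue <-]; rewrite lee_fin.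
Qed.

Section frechet.
Context {R : realType} {V W : normedModType R}.
Implicit Types (f : V -> W) (x : V).

Lemma frechet_remainder f x : differentiable f x -> forall e, 0 < e ->
  \forall u \near x, `|f u - f x - 'd f x (u - x)| <= e * `|u - x|.
Proof.
case=> -[_ /eqaddoP fx] e e0; apply: filterS (fx e e0) => u.
by rewrite /= lim_id// -addrA -opprD.
Qed.

Lemma differentiable_of_remainder f x (df : {linear V -> W}) : continuous df ->
  (forall e, 0 < e -> \forall h \near (0 : V), `|f (h + x) - f x - df h| <= e * `|h|) ->
  differentiable f x /\ 'd f x = df :> (V -> W).
Proof.
move=> dfc fe.
have fo : f \o shift x = cst (f x) + df +o_ (0 : V) id.
  apply/eqaddoP => e e0; apply: filterS (fe e e0) => h.
  by rewrite -addrA -opprD.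
have dE := diff_unique dfc fo; split=> //.
by apply/diff_locallyP; rewrite dE.
Qed.

Lemma continuous_linear_le (df : {linear V -> W}) : continuous df ->
  exists2 K, 0 <= K & forall h, `|df h| <= K * `|h|.
Proof.
move=> /linear_bounded_continuous/linear_boundedP/pinfty_ex_gt0[K K0 dK].
by exists K => //; exact: ltW.
Qed.

End frechet.

Section coderivative_of_differentiable.
Context {R : realType} (p q : R) (p1 : (1 <= p%:E)%E) (q1 : (1 <= q%:E)%E).
Hypothesis pq : p^-1 + q^-1 = 1.

(** For the inclusion from left to right, the difference [A] of the two
    functionals is tested along [u = x + s v] with [s] small.  Since
    [||f u - f x|| <= (K + 1) ||u - x||] near [x], where [K] bounds the derivative,
    the quotient being at most [e'] gives
    [A (s v) <= e' (K + 2 + ||y||) ||s v||]; dividing by [s] and letting [e'] tend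
    to [0] yields [A v <= 0], for [v] and for [- v].  Conversely, if [A] vanishes,
    the numerator is the pairing of [y] with the remainder of [f]. *)
Theorem coderivative_differentiable (f : lp p1 -> lp q1) (x y : lp p1) :
  differentiable f x ->
  coderivative f x y =
    [set z : lp q1 | forall v : lp p1, pairing z v = pairing y ('d f x v)].
Proof.
move=> df; have qp : q^-1 + p^-1 = 1 by rewrite addrC.
apply/seteqP; split=> z /=; rewrite /coderivative/= limf_esup_le0P.
- move=> zE.
  pose A (v : lp p1) := pairing z v - pairing y ('d f x v).
  have [K K0 dK] := continuous_linear_le (diff_continuous df).
  suff A0 (v : lp p1) : A v <= 0.
    move=> v; apply/eqP; rewrite -subr_eq0 eq_le A0/=.
    have dN : 'd f x (- v) = - 'd f x v by exact: raddfN.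
    have := A0 (- v); rewrite /A dN (pairingN qp z v) (pairingN pq y ('d f x v)).
    by rewrite -opprD oppr_le0.
  have [->|v0] := eqVneq v 0; first by rewrite /A raddf0 (pairing0 p1 qp) (pairing0 q1 pq) subrr.
  apply/ler_addgt0Pr => e e0; rewrite add0r.
  (* the bound on A v is C times that on the quotient *)
  pose C := `|v| * (K + 2 + `|y|).
  have C0 : 0 < C by rewrite mulr_gt0 ?normr_gt0// -addrA ltr_wpDl// ltr_pwDl.
  pose e' := e / C; have e'0 : 0 < e' by rewrite divr_gt0.
  have near1 := frechet_remainder df ltr01.
  have near2 := frechet_remainder df e'0.
  have near3 := zE _ e'0.
  have : \forall u \near x, [/\ `|f u - f x - 'd f x (u - x)| <= 1 * `|u - x|,
    `|f u - f x - 'd f x (u - x)| <= e' * `|u - x| & u != x ->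
    (pairing z (u - x) - pairing y (f u - f x)) / (`|u - x| + `|f u - f x|) <= e'].
    by near=> u; split; near: u.
  move=> /nbhs_normP[d /= d0 ball_d].
  pose s := d / (2 * `|v|); have v0' : 0 < `|v| by rewrite normr_gt0.
  have s0 : 0 < s by rewrite divr_gt0// mulr_gt0.
  have sv : `|s *: v| = d / 2.
    by rewrite normrZ gtr0_norm// /s invfM mulrA divfK// gt_eqF.
  have svd : 0 < `|s *: v| by rewrite sv divr_gt0.
  have ball_u : `|x - (s *: v + x)| < d.
    by rewrite opprD addrCA subrr addr0 normrN sv; lra.
  have uE : s *: v + x - x = s *: v by rewrite addrK.
  have ux : s *: v + x != x by rewrite -subr_eq0 uE -normr_gt0.
  pose F := f (s *: v + x) - f x; pose D := `|s *: v| + `|F|.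
  have [] := ball_d _ ball_u; rewrite -/F !uE -/D => r1 r2 /(_ ux).
  have D0 : 0 < D by rewrite ltr_pwDl.
  (* Lipschitz bound at x: the remainder estimate with constant 1 *)
  have FK : `|F| <= (K + 1) * `|s *: v|.
    rewrite -[F](subrK ('d f x (s *: v))) (le_trans (ler_normD _ _))//.
    by rewrite mulrDl addrC lerD.
  rewrite ler_pdivrMr// => quot'.
  have quot : pairing z (s *: v) - pairing y F <= e' * D.
    suff <- : pairing z (s *: v + x - x) = pairing z (s *: v) by exact: quot'.
    exact: (congr1 (fun u : lp p1 => pairing z u) uE).
  have rem : pairing y (F - 'd f x (s *: v)) <= `|y| * (e' * `|s *: v|).
    apply: (le_trans (ler_norm _)).
    by apply: (le_trans (pairing_le pq y (F - 'd f x (s *: v)))); rewrite ler_wpM2l.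
  have : s * A v <= s * e.
    have -> : s * A v = pairing z (s *: v) - pairing y F + pairing y (F - 'd f x (s *: v)).
      have dZ : 'd f x (s *: v) = s *: 'd f x v by rewrite linearZ.
      rewrite (pairingB pq y F ('d f x (s *: v))) dZ (pairingZ qp z v).
      by rewrite (pairingZ pq y ('d f x v)) /A; ring.
    have -> : s * e = e' * (`|s *: v| * (K + 2 + `|y|)).
      by rewrite normrZ gtr0_norm// /e' -[s * _ * _]mulrA -/C mulrCA divfK ?gt_eqF.
    apply: (le_trans (lerD quot rem)).
    have -> : e' * (`|s *: v| * (K + 2 + `|y|)) =
      e' * (`|s *: v| + (K + 1) * `|s *: v|) + `|y| * (e' * `|s *: v|) by ring.
    by rewrite lerD2r ler_wpM2l ?(ltW e'0)// lerD2l.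
  by rewrite ler_pM2l.
- move=> zE e e0.
  have y1 : 0 < `|y| + 1 by rewrite ltr_wpDl.
  have e'0 : 0 < e / (`|y| + 1) by rewrite divr_gt0.
  apply: nbhs_dnbhs; apply: filterS (frechet_remainder df e'0) => u ru.
  pose D := `|u - x| + `|f u - f x|.
  suff : (pairing y ('d f x (u - x)) - pairing y (f u - f x)) / D <= e.
    by rewrite -zE.
  have [->|D0] := eqVneq D 0; first by rewrite invr0 mulr0 ltW.
  have Dge : 0 <= D by rewrite addr_ge0.
  rewrite ler_pdivrMr ?lt_def ?D0// -(pairingB pq y ('d f x (u - x)) (f u - f x)).
  apply: (le_trans (ler_norm _)).
  apply: (le_trans (pairing_le pq y ('d f x (u - x) - (f u - f x)))); rewrite distrC.
  apply: (@le_trans _ _ (`|y| * (e / (`|y| + 1) * `|u - x|))).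
    by rewrite ler_wpM2l.
  have -> : `|y| * (e / (`|y| + 1) * `|u - x|) = e * ((`|y| / (`|y| + 1)) * `|u - x|) by ring.
  rewrite ler_wpM2l ?(ltW e0)// -[leRHS]mul1r ler_pM// ?divr_ge0//.
    by rewrite ler_pdivrMr// mul1r lerDl.
  by rewrite lerDl.
Unshelve. all: by end_near. Qed.

End coderivative_of_differentiable.

(** * Unit sequences *)

Section unit_sequences.
Context {R : realType}.

Let delta (n k : nat) : R := (k == n)%:R.

Lemma mem_lp_delta (p : R) n : (1 <= p%:E)%E ->
  delta n \in Lfun (@counting nat R) p%:E.
Proof.
move=> p1; apply/mem_lp => //.
rewrite (@nneseriesD1 _ _ n)//.
rewrite eseries0 ?adde0 ?ltry// => k _ /= kn.
by rewrite /delta (negbTE kn) normr0 powR0// gt_eqF// lp_exponent_gt0.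
Qed.

Lemma pairing_delta (z : nat -> R) n : pairing z (delta n) = z n.
Proof.
apply/cvg_lim => //; apply: cvg_near_cst; exists n.+1 => //= N nN.
rewrite /series/= (bigD1_seq n) ?iota_uniq ?mem_index_iota//= /delta eqxx mulr1.
by rewrite big1 ?addr0// => k /negbTE ->; rewrite mulr0.
Qed.

Lemma pairing_inj (p : R) (p1 : (1 <= p%:E)%E) (z z' : nat -> R) :
  (forall u : lp p1, pairing z u = pairing z' u) -> z = z'.
Proof.
move=> zz'; apply/funext => n; rewrite -[LHS]pairing_delta -[RHS]pairing_delta.
exact: zz' (Lfun_Sub p1 (mem_lp_delta n p1)).
Qed.

End unit_sequences.

(** * The derivative and the coderivative of [J] *)

Section derivative_of_J.
Context {R : realType} (p q : R) (p3 : 3 < p) (pq : p^-1 + q^-1 = 1).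

Let P1 := exponent_ge1 p3.
Let Q1 := conjugate_ge1 p3 pq.

Let pqE : (p - 1) * q = p.
Proof.
have p0 := lp_exponent_gt0 P1; have q0 := lp_exponent_gt0 Q1.
have : (p^-1 + q^-1) * (p * q) = q + p by field; rewrite !gt_eqF.
by rewrite pq; lra.
Qed.

Let p1ge0 : 0 <= p - 1. Proof. by have := p3; lra. Qed.

(** Bounding [|x n|] and [|v n|] by their sum turns [|x n|^(p-2) |v n|] into a
    [(p-1)]-th power of an element of l_p. *)
Lemma multiplier_dominated (x v w : lp P1) n : w n = `|x n| + `|v n| ->
  `|diag_mul (J_multiplier p x) v n| <= (p - 1) * `|w n| `^ (p - 1).
Proof.
move=> ->; set a := x n; set b := v n.
rewrite /diag_mul normrM -/a -/b -[J_multiplier p x n]/(damped_power_deriv p a).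
rewrite ger0_norm ?damped_power_deriv_ge0// [in leRHS]ger0_norm ?addr_ge0//.
have -> : (`|a| + `|b|) `^ (p - 1) = (`|a| + `|b|) `^ (p - 2) * (`|a| + `|b|).
  rewrite [RHS]mulrC -(_ : p - 1 - 1 = p - 2) ?mulr_powRB1 ?addr_ge0//; have := p3; lra.
rewrite mulrA ler_pM ?damped_power_deriv_ge0 ?lerDr//.
apply: (le_trans (damped_power_deriv_le _ p3)); rewrite ler_wpM2l//.
have p2 : 0 <= p - 2 by have := p3; lra.
by rewrite (ge0_ler_powR p2) ?nnegrE ?addr_ge0 ?lerDl.
Qed.

Lemma mem_lq_multiplier (x v : lp P1) :
  diag_mul (J_multiplier p x) v \in Lfun (@counting nat R) q%:E.
Proof.
have [w wE _] := lp_sum_of_norms x v.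
apply: (mem_lq_dominated Q1 pqE p1ge0) => n.
exact: multiplier_dominated (wE n).
Qed.

Definition multiplier_op (x v : lp P1) : lp Q1 :=
  Lfun_Sub Q1 (mem_lq_multiplier x v).

Let multiplier_op_linear x : linear (multiplier_op x).
Proof.
move=> c u v; apply: lp_ext => n.
rewrite -[LHS]/(J_multiplier p x n * (c * u n + v n)).
by rewrite -[RHS]/(c * (J_multiplier p x n * u n) + J_multiplier p x n * v n); ring.
Qed.

HB.instance Definition _ x :=
  GRing.isLinear.Build R (lp P1) (lp Q1) *:%R (multiplier_op x)
    (multiplier_op_linear x).

Lemma multiplier_op_continuous x : continuous (multiplier_op x).
Proof.
apply/linear_bounded_continuous/bounded_funP => r.
exists ((p - 1) * (`|x| + r) `^ (p - 1)) => v vr.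
have [w wE wle] := lp_sum_of_norms x v.
have := lq_norm_dominated pqE p1ge0 (fun n => multiplier_dominated (wE n)
  : `|multiplier_op x v n| <= _).
move=> /le_trans; apply; rewrite ler_wpM2l// ge0_ler_powR ?nnegrE//.
  by rewrite addr_ge0// (le_trans _ vr).
by rewrite (le_trans wle)// lerD2l.
Qed.

(** The quadratic gain comes from scaling: with [h = ||h|| k] and [||h|| <= 1],
    [(|x n| + |h n|)^(p-3) (h n)^2] is at most
    [||h||^2 (|x n| + |k n|)^(p-3) (k n)^2], hence at most
    [||h||^2 (|x n| + |k n|)^(p-1)]. *)
Lemma J_remainder (x h : lp P1) : `|h| <= 1 ->
  `|J p3 pq (h + x) - J p3 pq x - multiplier_op x h| <=
  4 * p ^+ 2 * (`|x| + 1) `^ (p - 1) * `|h| ^+ 2.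
Proof.
move=> h1; have [->|h0] := eqVneq h 0.
  by rewrite add0r subrr linear0 subr0 !normr0 expr0n mulr0.
have nh0 : 0 < `|h| by rewrite normr_gt0.
have [w wE wle] := lp_sum_of_norms x (`|h|^-1 *: h).
have k1 : `| `|h|^-1 *: h| = 1 by rewrite normrZ normfV normr_id mulVf ?gt_eqF.
rewrite k1 in wle.
have c0 : 0 <= 4 * p ^+ 2 * `|h| ^+ 2 by rewrite mulr_ge0 ?sqr_ge0// mulr_ge0 ?sqr_ge0.
apply: (@le_trans _ _ (4 * p ^+ 2 * `|h| ^+ 2 * `|w| `^ (p - 1))); last first.
  by rewrite [leRHS]mulrAC ler_wpM2l// (ge0_ler_powR p1ge0) ?nnegrE ?addr_ge0.
apply: (lq_norm_dominated pqE c0) => n.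
suff : `|damped_power p (x n + h n) - damped_power p (x n) -
    damped_power_deriv p (x n) * h n| <=
    4 * p ^+ 2 * `|h| ^+ 2 * `|w n| `^ (p - 1) by rewrite [x n + h n]addrC.
apply: (le_trans (damped_power_taylor _ _ p3)).
rewrite -[leRHS]mulrA; apply: ler_wpM2l; first by rewrite mulr_ge0 ?sqr_ge0.
have wn : w n = `|x n| + `|h|^-1 * `|h n|.
  rewrite wE; congr (_ + _).
  by rewrite -[LHS]/(`| `|h|^-1 * h n |) normrM normfV normr_id.
have hn : `|h n| = `|h| * (`|h|^-1 * `|h n|) by rewrite mulVKf ?gt_eqF.
have k0 : 0 <= `|h|^-1 * `|h n| by rewrite mulr_ge0.
have w0 : 0 <= w n by rewrite wn addr_ge0.
rewrite (ger0_norm w0).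
have -> : w n `^ (p - 1) = w n `^ (p - 3) * w n ^+ 2.
  rewrite -(_ : p - 1 - 1 - 1 = p - 3); last by ring.
  by rewrite expr2 mulrC -mulrA !mulr_powRB1//; have := p3; lra.
rewrite [leRHS]mulrCA; apply: ler_pM; rewrite ?powR_ge0 ?sqr_ge0//.
  have p3' : 0 <= p - 3 by have := p3; lra.
  rewrite (ge0_ler_powR p3') ?nnegrE ?addr_ge0//.
  by rewrite wn lerD2l hn mulKf ?gt_eqF// ler_piMl.
rewrite -exprMn -[h n ^+ 2]real_normK ?num_real// lerXn2r ?nnegrE ?mulr_ge0//.
by rewrite {1}hn ler_wpM2l// wn lerDr.
Qed.

Lemma J_differentiable (x : lp P1) :
  differentiable (J p3 pq) x /\ 'd (J p3 pq) x = multiplier_op x :> (lp P1 -> lp Q1).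
Proof.
apply: differentiable_of_remainder; first exact: multiplier_op_continuous.
move=> e e0; pose C := 4 * p ^+ 2 * (`|x| + 1) `^ (p - 1).
have C0 : 0 <= C by rewrite mulr_ge0 ?powR_ge0// mulr_ge0 ?sqr_ge0.
have C1 : 0 < C + 1 by rewrite ltr_wpDl.
have d0 : 0 < e / (C + 1) by rewrite divr_gt0.
near=> h.
have h1 : `|h| <= 1 by near: h; exact: nbhs0_le.
have he : `|h| <= e / (C + 1) by near: h; exact: nbhs0_le.
apply: (le_trans (J_remainder x h1)); rewrite -/C expr2 mulrA ler_wpM2r//.
apply: (@le_trans _ _ ((C + 1) * (e / (C + 1)))); last by rewrite mulrC divfK// gt_eqF.
by rewrite ler_pM// lerDl.
Unshelve. all: by end_near. Qed.

Lemma pairing_multiplier_op (x u v : lp P1) :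
  pairing v (multiplier_op x u) = pairing (multiplier_op x v) u.
Proof.
congr (limn (series _)); apply/funext => n.
rewrite -[LHS]/(v n * (J_multiplier p x n * u n)).
by rewrite -[RHS]/(J_multiplier p x n * v n * u n); ring.
Qed.

Lemma coderivative_J (x v : lp P1) :
  coderivative (J p3 pq) x v = [set multiplier_op x v].
Proof.
have [dJ dE] := J_differentiable x.
rewrite (coderivative_differentiable pq v dJ) dE; apply/seteqP; split=> z /=.
  move=> zE; apply: lp_ext => n; congr (_ n); apply: (@pairing_inj _ _ P1) => u.
  by rewrite zE pairing_multiplier_op.
by move=> -> u; rewrite pairing_multiplier_op.
Qed.

End derivative_of_J.

Theorem theorem7p4 (R : realType) (p q : R)
    (p3 : 3 < p) (pq : p^-1 + q^-1 = 1) :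
  mordukhovich_differentiable (J p3 pq) /\
  forall xbar : lp (exponent_ge1 p3),
    differentiable (J p3 pq) xbar /\
    coderivative (J p3 pq) xbar = (fun v => [set 'd (J p3 pq) xbar v]) /\
    forall v : lp (exponent_ge1 p3),
      diag_mul (J_multiplier p xbar) v \in Lfun (@counting nat R) q%:E /\
      ('d (J p3 pq) xbar v : nat -> R) = diag_mul (J_multiplier p xbar) v.
Proof.
split=> [x y|x]; first by exists (multiplier_op pq x y); exact: coderivative_J.
have [dJ dE] := J_differentiable pq x; rewrite dE; split=> //; split.
  by apply/funext => v; exact: coderivative_J.
by move=> v; split; first exact: mem_lq_multiplier.
Qed.
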